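(* Let $G_1$ be a connected graph having no pair of false twins, and let $G_2$ be a graph whose false-twin equivalence classes $G^2_1,\dots,G^2_s$ all satisfy $|G^2_j|\ge 2$. Then $\mathrm{fix}(G_1*G_2)=|V(G_1)|\,\mathrm{fix}(G_2)$.
   Context: All graphs are finite and simple. For graphs $G_1,G_2$, the co-normal product $G_1*G_2$ is the graph with vertex set $V(G_1)\times V(G_2)$ in which $(a,b)$ and $(c,d)$ are adjacent if and only if $a$ is adjacent to $c$ in $G_1$ or $b$ is adjacent to $d$ in $G_2$. Two distinct vertices $u,v$ are false twins if $N(u)=N(v)$ (open neighborhoods); the false-twin equivalence classes are the classes of the relation $u\equiv v$ iff $N(u)=N(v)$. A set $F\subseteq V(G)$ is a fixing set of $G$ if the only automorphism of $G$ fixing every vertex of $F$ is the identity; $\mathrm{fix}(G)$ is the minimum cardinality of a fixing set. *)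

(* Defs.v *)
From HB Require Import structures.
From mathcomp Require Import all_boot all_fingroup.

Set Implicit Arguments.
Unset Strict Implicit.
Unset Printing Implicit Defensive.

Record sgraph := SGraph {
  vertex :> finType;
  adj : rel vertex;
  adj_sym : symmetric adj;
  adj_irrefl : irreflexive adj }.

Section Graphs.
Variable G : sgraph.
Implicit Types (u v : G) (F : {set G}) (f : {perm G}).

(* The null graph counts as connected, so hypotheses of connectedness do not
   exclude it. *)
Definition connected : Prop := forall u v, connect (@adj G) u v.

Definition open_nbhd u : {set G} := [set v | adj u v].

Definition false_twins u v : bool :=
  (u != v) && (open_nbhd u == open_nbhd v).

Definition false_twin_classes : {set {set G}} :=
  equivalence_partition [rel u v | open_nbhd u == open_nbhd v] [set: G].

Definition is_aut f : bool :=
  [forall u, forall v, adj (f u) (f v) == adj u v].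

Definition fixing_set F : bool :=
  [forall f : {perm G},
     is_aut f ==> [forall v in F, f v == v] ==> (f == 1%g)].

Lemma fixing_setT : fixing_set [set: G].
Proof.
apply/forallP=> f; apply/implyP=> _; apply/implyP=> /forall_inP fixT.
by apply/eqP/permP=> v; rewrite perm1; apply/eqP/fixT; rewrite inE.
Qed.

(* The arg min ranges over a nonempty family, by fixing_setT. *)
Definition fix_number : nat :=
  #|[arg min_(F < [set: G] | fixing_set F) #|F| ]|.

Lemma fix_numberP :
  (exists2 F, fixing_set F & #|F| = fix_number) /\
  (forall F, fixing_set F -> fix_number <= #|F|).
Proof.
rewrite /fix_number; case: arg_minnP => [|F fixF minF]; first exact: fixing_setT.
by split; first exists F.
Qed.

End Graphs.

Section Conormal.
Variables G1 G2 : sgraph.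

Definition conormal_adj : rel (G1 * G2)%type :=
  [rel p q | adj p.1 q.1 || adj p.2 q.2].

Lemma conormal_adj_sym : symmetric conormal_adj.
Proof. by move=> p q; rewrite /conormal_adj /= (adj_sym p.1) (adj_sym p.2). Qed.

Lemma conormal_adj_irrefl : irreflexive conormal_adj.
Proof. by move=> p; rewrite /conormal_adj /= !adj_irrefl. Qed.

Definition conormal : sgraph := SGraph conormal_adj_sym conormal_adj_irrefl.

End Conormal.

(* Main.v *)
(** When no vertex is alone in its false-twin class, a set is fixing exactly
    when its complement meets every class at most once: false twins can be
    swapped, and conversely an automorphism fixing all but at most one vertex
    of each class preserves every class, hence is trivial. So fix(G) is the
    size of the complement of a transversal of the classes. If G1 has no false
    twins, the classes of G1 * G2 are the sets {a} x C with C a class of G2, so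
    V(G1) x X is a transversal for G1 * G2 whenever X is one for G2. *)

Require Import Defs.
From HB Require Import structures.
From mathcomp Require Import all_boot all_fingroup.

Set Implicit Arguments.
Unset Strict Implicit.
Unset Printing Implicit Defensive.

Section FixingSets.
Variable G : sgraph.
Implicit Types (u v : G) (F X : {set G}) (f : {perm G}).

Lemma open_nbhd_aut f u : is_aut f -> open_nbhd (f u) = f @: open_nbhd u.
Proof.
move=> /forallP autf; apply/setP=> w; rewrite -[w](permKV f).
rewrite mem_imset; last exact: perm_inj.
by rewrite !inE; apply/eqP/(forallP (autf u)).
Qed.

Lemma tperm_aut u v : open_nbhd u = open_nbhd v -> is_aut (tperm u v).
Proof.
move=> /setP Nuv; have adjuv w : adj u w = adj v w.
  by have := Nuv w; rewrite !inE.
have adj_tperm w x : adj (tperm u v w) x = adj w x.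
  by case: tpermP => // ->.
apply/forallP=> w; apply/forallP=> x.
by rewrite adj_tperm adj_sym adj_tperm adj_sym.
Qed.

Lemma fixing_set_inj F : fixing_set F -> {in ~: F &, injective (@open_nbhd G)}.
Proof.
move=> /forallP fixF u v; rewrite !inE => uNF vNF Nuv.
have /implyP/(_ (tperm_aut Nuv))/implyP := fixF (tperm u v).
have -> : [forall w in F, tperm u v w == w].
  apply/forall_inP=> w wF; rewrite tpermD //.
    by apply: contraNneq uNF => ->.
  by apply: contraNneq vNF => ->.
by move=> /(_ isT)/eqP/permP/(_ u); rewrite tpermL perm1.
Qed.

Hypothesis has_twin : forall v, exists u, false_twins u v.

(** A vertex outside [F] has its twins in [F]; as [f] fixes these, it cannot move the vertex out of
    its class. *)
Lemma inj_fixing_set F : {in ~: F &, injective (@open_nbhd G)} -> fixing_set F.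
Proof.
move=> injF; apply/forallP=> f; apply/implyP=> autf.
apply/implyP=> /forall_inP fixf; apply/eqP/permP=> v; rewrite perm1.
have [vF | vNF] := boolP (v \in F); first exact/eqP/fixf.
have [u /andP[neq_uv /eqP Nuv]] := has_twin v.
have uF : u \in F.
  by apply: contraNT neq_uv => uNF; apply/eqP/injF; rewrite ?inE.
have Nfv : open_nbhd (f v) = open_nbhd v.
  by rewrite open_nbhd_aut // -Nuv -open_nbhd_aut // (eqP (fixf u uF)).
(* If [f v] lies in [F], then [f (f v) = f v] and [f] is injective; otherwise [v] and [f v] are
   twins outside [F]. *)
have [fvF | fvNF] := boolP (f v \in F).
  exact: (perm_inj (eqP (fixf _ fvF))).
by apply: injF; rewrite ?inE.
Qed.

Lemma fix_number_transversal X :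
    {in X &, injective (@open_nbhd G)} ->
    (forall v, exists2 x, x \in X & open_nbhd x = open_nbhd v) ->
  fix_number G = #|~: X|.
Proof.
move=> injX surjX; have [[F fixF cardF] minF] := fix_numberP G.
apply/eqP; rewrite eqn_leq minF /=; last first.
  by apply: inj_fixing_set; rewrite setCK.
(* It remains to see [#|~: F| <= #|X|]: both sets inject into the neighbourhoods, and [X] reaches
   all of them. *)
rewrite -cardF (cardsCs F) (cardsCs (~: X)) setCK leq_sub2l //.
rewrite -(card_in_imset (fixing_set_inj fixF)) -(card_in_imset injX).
apply/subset_leq_card/subsetP=> _ /imsetP[v _ ->].
by have [x xX <-] := surjX v; rewrite imset_f.
Qed.

End FixingSets.

Lemma exists_twin_transversal (G : sgraph) :
  exists2 X : {set G}, {in X &, injective (@open_nbhd G)} &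
    forall v, exists2 x, x \in X & open_nbhd x = open_nbhd v.
Proof.
pose twin u : pred G := fun w => open_nbhd w == open_nbhd u.
pose r u := choose (twin u) u.
have Nr u : open_nbhd (r u) = open_nbhd u.
  by apply/eqP/(@chooseP _ (twin u)); rewrite /twin.
exists (r @: [set: G]) => [_ _ /imsetP[u _ ->] /imsetP[v _ ->]|v]; last first.
  by exists (r v); rewrite ?imset_f.
(* Twins define the same predicate, and [choose] returns the same element from any starting point
   satisfying it. *)
rewrite !Nr => Nuv; rewrite /r /twin Nuv.
by apply: choose_id; rewrite ?Nuv.
Qed.

Lemma twin_class_gt1 (G : sgraph) :
    (forall C : {set G}, C \in false_twin_classes G -> 2 <= #|C|) ->
  forall v : G, exists u, false_twins u v.
Proof.
move=> gt1 v; pose C := [set u : G | open_nbhd v == open_nbhd u].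
have : C \in false_twin_classes G.
  by apply/imsetP; exists v => //; apply/setP=> u; rewrite !inE.
move=> /gt1; rewrite (cardsD1 v) inE eqxx ltnS => /card_gt0P[u].
by rewrite !inE eq_sym [_ == open_nbhd u]eq_sym eq_sym => ?; exists u.
Qed.

(* The non-neighbours of (a, b) form the product of those of a and of b; both
   factors are nonempty, so the product determines them. *)
Lemma open_nbhd_conormal (G1 G2 : sgraph) (p q : conormal G1 G2) :
  open_nbhd p = open_nbhd q <->
  open_nbhd p.1 = open_nbhd q.1 /\ open_nbhd p.2 = open_nbhd q.2.
Proof.
case: p q => [a b] [c d] /=; split=> [/setP Npq | [/setP Nac /setP Nbd]].
  have adjE x y : adj a x || adj b y = adj c x || adj d y.
    by have := Npq (x, y); rewrite !inE.
  (* [(a, b)] is not its own neighbour, hence not one of [(c, d)]; so setting [y = b] or [x = a] in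
     [adjE] isolates one coordinate. *)
  have /norP[/negbTE ca /negbTE db] : ~~ (adj c a || adj d b).
    by rewrite -adjE !adj_irrefl.
  split; apply/setP=> x; rewrite !inE.
    by have := adjE x b; rewrite adj_irrefl db !orbF.
  by have := adjE a x; rewrite adj_irrefl ca.
apply/setP=> [[x y]]; rewrite !inE /= /conormal_adj /=.
by have := Nac x; have := Nbd y; rewrite !inE => -> ->.
Qed.

Theorem theorem3p13 (G1 G2 : sgraph)
  (G1_connected : connected G1)
  (G1_twinfree : forall u v : G1, ~~ false_twins u v)
  (G2_classes : forall C : {set G2}, C \in false_twin_classes G2 -> 2 <= #|C|) :
  fix_number (conormal G1 G2) = #|G1| * fix_number G2.
Proof.
have twin2 := twin_class_gt1 G2_classes.
have [X injX surjX] := exists_twin_transversal G2.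
have injG1 : injective (@open_nbhd G1).
  move=> u v Nuv; have := G1_twinfree u v.
  by rewrite /false_twins Nuv eqxx andbT negbK => /eqP.
pose Y : {set conormal G1 G2} := setX [set: G1] X.
rewrite (fix_number_transversal twin2 injX surjX).
rewrite (@fix_number_transversal _ _ Y); first 1 last.
(* Twins in the product come from [G2] alone, with the first coordinate kept. *)
- move=> [a b]; have [c /andP[neq_cb /eqP Ncb]] := twin2 b.
  exists (a, c); rewrite /false_twins xpair_eqE eqxx neq_cb /=.
  exact/eqP/open_nbhd_conormal.
- move=> [a b] [c d]; rewrite !inE /= => bX dX /open_nbhd_conormal[/= Nac Nbd].
  by rewrite (injG1 _ _ Nac) (injX _ _ bX dX Nbd).
- move=> [a b]; have [x xX Nxb] := surjX b.
  by exists (a, x); [rewrite !inE | apply/open_nbhd_conormal].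
have -> : ~: Y = setX [set: G1] (~: X) by apply/setP=> p; rewrite !inE.
by rewrite cardsX cardsT.
Qed.
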